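(* Let $f: I\to\mathbb R$ be a convex function on an interval $I\subseteq\mathbb R$, let $[a,b]\subset I$ with $a<b$, let $x_1,\dots,x_n\in[a,b]$, and let $p_1,\dots,p_n>0$ with $\sum_{i=1}^n p_i=1$. Then $$0\le \sum_{i=1}^n p_i f(x_i)-f\Bigl(\sum_{i=1}^n p_i x_i\Bigr)\le f(a)+f(b)-2f\Bigl(\frac{a+b}{2}\Bigr)$$ and $$0\le f(a)+f(b)-\sum_{i=1}^n p_i f(x_i)-f\Bigl(a+b-\sum_{i=1}^n p_i x_i\Bigr)\le 2\Bigl[f(a)+f(b)-2f\Bigl(\frac{a+b}{2}\Bigr)\Bigr],$$ the upper bounds being independent of $(p_1,\dots,p_n)$. *)

(* Defs.v *)
From mathcomp Require Export all_boot all_order all_algebra.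
From mathcomp Require Export classical_sets reals topology normedtype convex.

Set Implicit Arguments.
Unset Strict Implicit.
Unset Printing Implicit Defensive.

(* Main.v *)
Require Import Defs.
From mathcomp Require Import all_boot all_order all_algebra.
From mathcomp Require Import classical_sets reals topology normedtype convex.
From mathcomp Require Import interval_inference lra ring.

Set Implicit Arguments.
Unset Strict Implicit.
Unset Printing Implicit Defensive.

Import Order.TTheory GRing.Theory Num.Theory.
Local Open Scope classical_set_scope.
Local Open Scope ring_scope.

(** Write [m] for the mean of the [x i], [S] for the mean of the [f (x i)], and
    [c] for the midpoint of [a, b].  The reflection [y |-> a + b - y] preserves
    [a, b], and pairs each [y] with a point such that the two together have
    the same sum as the pair [a, b], but are at most as spread out, and at least as
    spread out as the pair [c, c].  Convexity therefore gives
      [2 f c <= f y + f (a + b - y) <= f a + f b].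
    Jensen's inequality at the points [x i] is [f m <= S]; at the reflected
    points, combined with the right-hand bound for every [y = x i], it becomes
    Mercer's inequality [S + f (a + b - m) <= f a + f b].  All four bounds are
    linear consequences of these two and of the left-hand bound at [y = m]. *)

(** Turns the weights of type [{i01 R}] and the operation [<| |>] of
    [convex_function] into real arithmetic. *)
Lemma convex_function_le (R : realType) (I : set R) (f : R -> R) (t x y : R) :
  @convex_function R R^o I f -> 0 <= t <= 1 -> I x -> I y ->
  f (t * x + (1 - t) * y) <= t * f x + (1 - t) * f y.
Proof.
move=> cvxf t01 Ix Iy.
exact: (cvxf (Itv01 (andP t01).1 (andP t01).2) x y (mem_set Ix) (mem_set Iy)).
Qed.

Lemma interval_convex_comb (R : realType) (I : set R) (t x y : R) :
  is_interval I -> 0 <= t <= 1 -> I x -> I y -> I (t * x + (1 - t) * y).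
Proof.
move=> itvI /andP[t0 t1] Ix Iy.
have [xy|/ltW yx] := leP x y.
  by apply: (itvI x y) => //; apply/andP; split; nra.
by apply: (itvI y x) => //; apply/andP; split; nra.
Qed.

(** Membership of the mean in [I] is proved jointly with the inequality, since
    the induction applies convexity to the first point and the weighted mean of
    the others. *)
Lemma jensen_sum (R : realType) (I : set R) (f : R -> R) (n : nat)
    (x p : 'I_n -> R) :
  is_interval I -> @convex_function R R^o I f ->
  (forall i, I (x i)) -> (forall i, 0 <= p i) -> \sum_(i < n) p i = 1 ->
  I (\sum_(i < n) p i * x i) /\
  f (\sum_(i < n) p i * x i) <= \sum_(i < n) p i * f (x i).
Proof.
move=> itvI cvxf; elim: n x p => [|n IHn] x p Ix p_ge0.
  by rewrite big_ord0 => /esym/eqP; rewrite oner_eq0.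
rewrite !big_ord_recl; set p0 := p ord0; set q := fun i => p (lift ord0 i).
move=> sum_p; have sum_q : \sum_(i < n) q i = 1 - p0.
  by apply/eqP; rewrite eq_sym subr_eq addrC sum_p.
have q_ge0 i : 0 <= q i by exact: p_ge0.
have p0_ge0 : 0 <= p0 by exact: p_ge0.
have p0_le1 : 0 <= 1 - p0 by rewrite -sum_q sumr_ge0.
(* The remaining weights can only be renormalized when [p0] is not 1. *)
have [p0_1|p0_neq1] := eqVneq (1 - p0) 0.
  have q0 i : q i = 0.
    by apply: (psumr_eq0P (P := predT)) => //; rewrite sum_q.
  have sum_q0 (g : 'I_n -> R) : \sum_(i < n) q i * g i = 0.
    by apply: big1 => i _; rewrite q0 mul0r.
  have -> : p0 = 1 by lra.
  by rewrite !sum_q0 !mul1r !addr0.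
have factor_q (g : 'I_n -> R) :
    \sum_(i < n) q i * g i = (1 - p0) * \sum_(i < n) (q i / (1 - p0)) * g i.
  by rewrite mulr_sumr; apply: eq_bigr => i _; field.
have [|||Iy fy] := IHn (fun i => x (lift ord0 i)) (fun i => q i / (1 - p0)).
- by move=> i; exact: Ix.
- by move=> i; rewrite divr_ge0.
- by rewrite -mulr_suml sum_q divff.
rewrite !factor_q; have p0_01 : 0 <= p0 <= 1 by rewrite p0_ge0 -subr_ge0.
split; first exact: interval_convex_comb.
apply: le_trans (convex_function_le cvxf p0_01 (Ix ord0) Iy) _.
by rewrite lerD2l ler_wpM2l.
Qed.

(** If [y] is the combination of [a] and [b] with weights [t] and [1 - t], its
    reflection has these weights exchanged, so the two chord bounds add up to
    [f a + f b]. *)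
Lemma convex_reflection_le (R : realType) (f : R -> R) (a b y : R) :
  @convex_function R R^o [set` `[a, b]] f -> a < b -> y \in `[a, b] ->
  f y + f (a + b - y) <= f a + f b.
Proof.
move=> cvxf ltab; rewrite in_itv /= => /andP[ay yb].
have aab : a \in `[a, b] by rewrite bound_itvE ltW.
have bab : b \in `[a, b] by rewrite bound_itvE ltW.
pose t := (b - y) / (b - a).
have ba_gt0 : 0 < b - a by rewrite subr_gt0.
have t_ge0 : 0 <= t by rewrite divr_ge0 ?subr_ge0 // ltW.
have t_le1 : t <= 1 by rewrite ler_pdivrMr // mul1r lerD2l lerN2.
have tba : t * (b - a) = b - y by rewrite divfK // gt_eqF.
have t01 : 0 <= t <= 1 by rewrite t_ge0.
have fy := convex_function_le cvxf t01 aab bab.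
have fy' := convex_function_le cvxf t01 bab aab.
have Ey : t * a + (1 - t) * b = y by lra.
have Ey' : t * b + (1 - t) * a = a + b - y by lra.
rewrite Ey in fy; rewrite Ey' in fy'; lra.
Qed.

Lemma convex_midpoint_le (R : realType) (I : set R) (f : R -> R) (x y : R) :
  @convex_function R R^o I f -> I x -> I y ->
  2 * f ((x + y) / 2) <= f x + f y.
Proof.
move=> cvxf Ix Iy.
have half01 : 0 <= (2^-1 : R) <= 1 by lra.
have := convex_function_le cvxf half01 Ix Iy.
have -> : 2^-1 * x + (1 - 2^-1) * y = (x + y) / 2 by field.
lra.
Qed.

(** Mercer's inequality: Jensen's inequality at the reflected points, each of
    whose values is at most [f a + f b - f (x i)]. *)
Lemma jensen_mercer (R : realType) (f : R -> R) (a b : R) (n : nat)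
    (x p : 'I_n -> R) :
  @convex_function R R^o [set` `[a, b]] f -> a < b ->
  (forall i, x i \in `[a, b]) ->
  (forall i, 0 <= p i) -> \sum_(i < n) p i = 1 ->
  \sum_(i < n) p i * f (x i) + f (a + b - \sum_(i < n) p i * x i) <= f a + f b.
Proof.
move=> cvxf ltab xab p_ge0 sum_p.
have sum_pB (c : R) (g : 'I_n -> R) :
    \sum_(i < n) p i * (c - g i) = c - \sum_(i < n) p i * g i.
  under eq_bigr => i _ do rewrite mulrBr.
  by rewrite sumrB -mulr_suml sum_p mul1r.
have x'ab i : a + b - x i \in `[a, b] by move: (xab i); rewrite !in_itv /=; lra.
have [_] := jensen_sum (@interval_is_interval _ `[a, b]) cvxf x'ab p_ge0 sum_p.
rewrite sum_pB => le_f; rewrite addrC -lerBrDr -[leRHS]sum_pB; apply: le_trans le_f _.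
apply: ler_sum => i _; rewrite ler_wpM2l // lerBrDl.
exact: convex_reflection_le cvxf ltab (xab i).
Qed.

Theorem theorem2p1 (R : realType) (I : set R) (f : R -> R) (a b : R)
    (n : nat) (x p : 'I_n -> R)
    (itvI : is_interval I)
    (cvxf : @convex_function R R^o I f)
    (ltab : a < b)
    (subI : [set` `[a, b]] `<=` I)
    (xab : forall i, x i \in `[a, b])
    (p_gt0 : forall i, 0 < p i)
    (sum_p : \sum_(i < n) p i = 1) :
  (0 <= \sum_(i < n) p i * f (x i) - f (\sum_(i < n) p i * x i)
     <= f a + f b - 2 * f ((a + b) / 2)) /\
  (0 <= f a + f b - \sum_(i < n) p i * f (x i)
        - f (a + b - \sum_(i < n) p i * x i)
     <= 2 * (f a + f b - 2 * f ((a + b) / 2))).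
Proof.
(* On [a, b] itself, Jensen's lemma also places the mean in [a, b]. *)
have cvxab : @convex_function R R^o [set` `[a, b]] f.
  by move=> t y z /set_mem yab /set_mem zab; apply: cvxf; apply/mem_set/subI.
have p_ge0 i : 0 <= p i by exact/ltW.
have mercer := jensen_mercer cvxab ltab xab p_ge0 sum_p.
have [mab jensen] :=
  jensen_sum (@interval_is_interval _ `[a, b]) cvxab xab p_ge0 sum_p.
set m := \sum_(i < n) p i * x i in mercer jensen mab *.
have m'ab : a + b - m \in `[a, b] by move: mab; rewrite /= !in_itv /=; lra.
have := convex_midpoint_le cvxab mab m'ab.
have -> : m + (a + b - m) = a + b by ring.
move=> midpoint; split; lra.
Qed.
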